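(* Let $g:\mathbb{R}^m\to\mathbb{R}$ be a (not necessarily convex) Fréchet differentiable function whose gradient is $L_g$-Lipschitz continuous, let $\alpha>0$, $\beta\in(0,1)$, $0<s<\frac{2(1-\beta)}{L_g}$, let $x_0,x_{-1}\in\mathbb{R}^m$, and let $(x_n)_{n\in\mathbb{N}}$ be generated, for all $n\in\mathbb{N}$, by $$y_n=x_n+\frac{\beta n}{n+\alpha}(x_n-x_{n-1}),\qquad x_{n+1}=y_n-s\nabla g(y_n).$$ Assume that $g$ is bounded from below and consider the function $$H:\mathbb{R}^m\times\mathbb{R}^m\to\mathbb{R},\quad H(x,y)=g(x)+\tfrac12\|y-x\|^2.$$ Let $x^*$ be a cluster point of the sequence $(x_n)_{n\in\mathbb{N}}$ and assume that $H$ has the Kurdyka-Łojasiewicz property at $z^*=(x^*,x^* )$. Then the sequence $(x_n)_{n\in\mathbb{N}}$ converges to $x^*$ and $x^*$ is a critical point of $g$, i.e. $\nabla g(x^* )=0$.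
   Context: $\mathbb{N}=\{0,1,2,\dots\}$; $\|\cdot\|$ is the Euclidean norm ($\mathbb{R}^m\times\mathbb{R}^m$ carries the Euclidean norm of $\mathbb{R}^{2m}$). $L_g$-Lipschitz gradient means: $L_g\ge 0$ and $\|\nabla g(x)-\nabla g(y)\|\le L_g\|x-y\|$ for all $x,y\in\mathbb{R}^m$. Kurdyka-Łojasiewicz (KL) property. For $\eta\in(0,+\infty]$, $\Theta_\eta$ denotes the class of concave and continuous functions $\varphi:[0,\eta)\to[0,+\infty)$ such that $\varphi(0)=0$, $\varphi$ is continuously differentiable on $(0,\eta)$, continuous at $0$, and $\varphi'(t)>0$ for all $t\in(0,\eta)$. A differentiable function $f:\mathbb{R}^d\to\mathbb{R}$ satisfies the KL property at $\overline{x}\in\mathbb{R}^d$ if there exist $\eta\in(0,+\infty]$, a neighborhood $U$ of $\overline{x}$ and $\varphi\in\Theta_\eta$ such that for all $x\in U\cap\{x\in\mathbb{R}^d: f(\overline{x})<f(x)<f(\overline{x})+\eta\}$ one has $\varphi'(f(x)-f(\overline{x}))\|\nabla f(x)\|\ge 1$. *)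

(* Defs.v *)
(* Built on MathComp-Analysis, over an arbitrary [R : realType]. *)
From HB Require Import structures.
From mathcomp Require Import all_boot all_order all_algebra.
From mathcomp Require Import all_classical all_reals all_analysis.

Set Implicit Arguments.
Unset Strict Implicit.
Unset Printing Implicit Defensive.

Import Order.TTheory GRing.Theory Num.Theory.
Import numFieldNormedType.Exports.

Local Open Scope classical_set_scope.
Local Open Scope ring_scope.

(* The library's norm on ['rV[R]_d] is the sup norm.  It is equivalent to
   [enorm], so the library's topology, convergence and Frechet derivative are
   the Euclidean ones, but quantitative estimates have to use [enorm]. *)
Definition enorm (R : realType) (d : nat) (v : 'rV[R]_d) : R :=
  Num.sqrt (\sum_(i < d) v 0 i ^+ 2).

Definition gradient (R : realType) (d : nat) (f : 'rV[R]_d -> R)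
    (x : 'rV[R]_d) : 'rV[R]_d :=
  \row_(i < d) 'd f x (delta_mx 0 i).

(* This holds for every [f] only because ['d f x] is total; it is the
   derivative of [f] when [f] is differentiable at [x]. *)
Lemma gradientE (R : realType) (d : nat) (f : 'rV[R]_d -> R)
    (x v : 'rV[R]_d) :
  'd f x v = \sum_(i < d) gradient f x 0 i * v 0 i.
Proof.
rewrite {1}(row_sum_delta v) linear_sum; apply: eq_bigr => i _.
by rewrite linearZ /gradient mxE mulrC.
Qed.

Definition lipschitz_gradient (R : realType) (d : nat) (L : R)
    (f : 'rV[R]_d -> R) : Prop :=
  [/\ forall x, differentiable f x,
      0 <= L &
      forall x y,
        enorm (gradient f x - gradient f y) <= L * enorm (x - y)].

(* The class Theta_eta.  A function on [0, eta[ is represented by a total one,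
   whose values outside [0, eta[ are unconstrained and irrelevant; continuity
   at 0 is the one-sided one, relative to [0, eta[. *)
Definition desingularizing (R : realType) (eta : \bar R) (phi : R -> R) : Prop :=
  let I := [set t : R | 0 <= t /\ (t%:E < eta)%E] in
  [/\ forall t, I t -> 0 <= phi t,
      convex_function (I : set R^o) (\- phi),
      {within I, continuous phi},
      phi 0 = 0 &
      forall t : R, 0 < t -> (t%:E < eta)%E ->
        [/\ derivable phi t 1,
            {for t, continuous (derive1 phi)} &
            0 < derive1 phi t]].

Definition KL_property (R : realType) (d : nat) (f : 'rV[R]_d -> R)
    (xbar : 'rV[R]_d) : Prop :=
  (forall x, differentiable f x) /\
  exists (eta : \bar R) (U : set 'rV[R]_d) (phi : R -> R),
    [/\ (0 < eta)%E,
        nbhs xbar U,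
        desingularizing eta phi &
        forall x, U x ->
          f xbar < f x -> ((f x)%:E < (f xbar)%:E + eta)%E ->
          1 <= derive1 phi (f x - f xbar) * enorm (gradient f x)].

(* The term of index n - 1 of the sequence (x_n)_(n >= -1), where [xm1] is the
   term of index -1. *)
Definition prev_term (T : Type) (xm1 : T) (x : nat -> T) (n : nat) : T :=
  if n is k.+1 then x k else xm1.

Definition Hfun (R : realType) (m : nat) (g : 'rV[R]_m -> R)
    (x y : 'rV[R]_m) : R :=
  g x + 2^-1 * enorm (y - x) ^+ 2.

(* R^m x R^m with the Euclidean norm of R^(2m) is ['rV[R]_(m + m)], the pair
   (x, y) being [row_mx x y]. *)
Definition Hrow (R : realType) (m : nat) (g : 'rV[R]_m -> R)
    (z : 'rV[R]_(m + m)) : R :=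
  Hfun g (lsubmx z) (rsubmx z).

(* Main.v *)
Require Import Defs.
From HB Require Import structures.
From mathcomp Require Import all_boot all_order all_algebra.
From mathcomp Require Import all_classical all_reals all_analysis.
From mathcomp Require Import ring lra.

Set Implicit Arguments.
Unset Strict Implicit.
Unset Printing Implicit Defensive.

Import Order.TTheory GRing.Theory Num.Theory.
Import numFieldNormedType.Exports.

Local Open Scope classical_set_scope.
Local Open Scope ring_scope.

(* With d_n = x_n - x_(n-1) and a_n = |d_n| + |d_(n+1)|, the descent lemma along
   y_n -> y_(n+1) shows that, for a suitable constant del >= 0, the energy
   E_n = g(y_n) + (del / s) |d_n|^2 eventually satisfies
   E_n - E_(n+1) >= c a_n^2.  The energy is H(z_n) for
   z_n = (y_n, y_n + sqrt(2 del / s) d_n), and |grad H(z_n)| <= C a_n, so the KL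
   inequality and the concavity of phi give
   a_n <= (C / c) (phi(E_n - l) - phi(E_(n+1) - l)), where l = H(xs, xs): the
   decrease controls a_n itself and no square root has to be split.  Hence
   |x_n - xs| + (C / c) phi(E_n - l) does not increase as long as z_n stays in
   the KL neighbourhood; started close enough to the cluster point it never
   leaves, and the starting value can be taken arbitrarily small. *)

(** * Euclidean inner product and norm *)

Definition dotr (R : realType) (d : nat) (u v : 'rV[R]_d) : R :=
  \sum_(i < d) u 0 i * v 0 i.

Section Euclidean.
Variables (R : realType) (d : nat).
Implicit Types (u v w : 'rV[R]_d) (a : R).

Lemma dotrC u v : dotr u v = dotr v u.
Proof. by apply: eq_bigr => i _; rewrite mulrC. Qed.

Lemma dotrDr u v w : dotr u (v + w) = dotr u v + dotr u w.
Proof. by rewrite -big_split; apply: eq_bigr => i _; rewrite mxE mulrDr. Qed.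

Lemma dotrZr a u v : dotr u (a *: v) = a * dotr u v.
Proof. by rewrite mulr_sumr; apply: eq_bigr => i _; rewrite mxE mulrCA. Qed.

Lemma dotrNr u v : dotr u (- v) = - dotr u v.
Proof. by rewrite -scaleN1r dotrZr mulN1r. Qed.

Lemma dotrDl u v w : dotr (v + w) u = dotr v u + dotr w u.
Proof. by rewrite dotrC dotrDr !(dotrC u). Qed.

Lemma dotrZl a u v : dotr (a *: u) v = a * dotr u v.
Proof. by rewrite dotrC dotrZr dotrC. Qed.

Lemma dotrNl u v : dotr (- u) v = - dotr u v.
Proof. by rewrite dotrC dotrNr dotrC. Qed.

Definition dotrE := (dotrDl, dotrDr, dotrZl, dotrZr, dotrNl, dotrNr).

Lemma enorm_ge0 u : 0 <= enorm u.
Proof. exact: sqrtr_ge0. Qed.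

Lemma enorm_sqr u : enorm u ^+ 2 = dotr u u.
Proof.
rewrite sqr_sqrtr; last by apply: sumr_ge0 => i _; exact: sqr_ge0.
by apply: eq_bigr => i _; rewrite expr2.
Qed.

Lemma enormZ a u : enorm (a *: u) = `|a| * enorm u.
Proof.
apply/eqP; rewrite -(@eqrXn2 _ 2) ?mulr_ge0 ?enorm_ge0 //.
by rewrite exprMn !enorm_sqr !dotrE real_normK ?num_real // mulrA -expr2.
Qed.

Lemma enormN u : enorm (- u) = enorm u.
Proof. by rewrite -scaleN1r enormZ normrN1 mul1r. Qed.

Lemma coord_le_enorm u i : `|u 0 i| <= enorm u.
Proof.
rewrite -(@ler_pXn2r _ 2) ?nnegrE ?enorm_ge0 // real_normK ?num_real //.
rewrite enorm_sqr /dotr (bigD1 i) //= -expr2 lerDl.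
by apply: sumr_ge0 => j _; rewrite -expr2 sqr_ge0.
Qed.

Lemma enorm_eq0 u : enorm u = 0 -> u = 0.
Proof.
move=> u0; apply/rowP => i; rewrite mxE; apply/eqP.
by rewrite -normr_le0 -u0 coord_le_enorm.
Qed.

Lemma enorm_sqrDZ a u v : enorm (u + a *: v) ^+ 2 =
  enorm u ^+ 2 + 2 * a * dotr u v + a ^+ 2 * enorm v ^+ 2.
Proof. by rewrite !enorm_sqr !dotrE (dotrC v u); ring. Qed.

(** The square of the norm of [|v| u - |u| v] expands to [2 |u| |v| (|u| |v| - <u, v>)]; when both
    norms are nonzero, [2 |u| |v|] can be divided out. *)
Lemma cauchy_schwarz u v : dotr u v <= enorm u * enorm v.
Proof.
have [/enorm_eq0 ->|u0] := eqVneq (enorm u) 0.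
  by rewrite -(scale0r u) dotrZl mul0r mulr_ge0 ?enorm_ge0.
have [/enorm_eq0 ->|v0] := eqVneq (enorm v) 0.
  by rewrite -(scale0r v) dotrZr mul0r mulr_ge0 ?enorm_ge0.
have uv : 0 < enorm u * enorm v by rewrite mulr_gt0 // lt0r ?u0 ?v0 enorm_ge0.
have := sqr_ge0 (enorm (enorm v *: u - enorm u *: v)).
rewrite enorm_sqr !dotrE (dotrC v u) -!enorm_sqr => h.
by rewrite -(ler_pM2l uv); nra.
Qed.

Lemma enormD u v : enorm (u + v) <= enorm u + enorm v.
Proof.
rewrite -(@ler_pXn2r _ 2) ?nnegrE ?addr_ge0 ?enorm_ge0 //.
rewrite -(scale1r v) enorm_sqrDZ scale1r.
by have := cauchy_schwarz u v; nra.
Qed.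

Lemma enormB u v : enorm (u - v) <= enorm u + enorm v.
Proof. by rewrite -(enormN v) enormD. Qed.

Lemma mxnorm_le_enorm u : `|u| <= enorm u.
Proof.
rewrite /Num.norm /= mx_normrE.
apply: bigmax_le => [|[i j] _]; first exact: enorm_ge0.
by rewrite (ord1 i) coord_le_enorm.
Qed.

(** The factor [d.+1], instead of the sharp square root of [d], stays positive for [d = 0];
    [nbhs_enormP] divides by it. *)
Lemma enorm_le_mxnorm u : enorm u <= d.+1%:R * `|u|.
Proof.
have coord i : `|u 0 i| <= `|u|.
  rewrite [leRHS]/Num.norm /= mx_normrE.
  exact: (le_bigmax _ (fun ij : 'I_1 * 'I_d => `|u ij.1 ij.2|) (ord0, i)).
rewrite -(@ler_pXn2r _ 2) ?nnegrE ?mulr_ge0 ?enorm_ge0 //.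
apply: (@le_trans _ _ (\sum_(i < d) `|u| ^+ 2)).
  rewrite enorm_sqr; apply: ler_sum => i _.
  by rewrite -expr2 -real_normK ?num_real // lerXn2r ?nnegrE.
rewrite sumr_const card_ord exprMn -[leLHS]mulr_natl.
rewrite ler_wpM2r ?sqr_ge0 //.
by rewrite -natrX ler_nat (leq_trans (leqnSn d)) // -mulnn leq_pmulr.
Qed.

Lemma nbhs_enormP u (P : set 'rV[R]_d) :
  nbhs u P <-> exists2 e, 0 < e & forall v, enorm (v - u) < e -> P v.
Proof.
split=> [/nbhs_normP[e /= e0 ueP]|[e e0 ueP]].
  exists e => // v vu; apply: ueP; rewrite /= distrC.
  exact: le_lt_trans (mxnorm_le_enorm _) vu.
apply/(@nbhs_normP _ _ u P); exists (e / d.+1%:R); first by rewrite /= divr_gt0.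
move=> v /=; rewrite distrC ltr_pdivlMr // mulrC => vu.
exact/ueP/(le_lt_trans (enorm_le_mxnorm _)).
Qed.

End Euclidean.

Lemma enorm_row_mx (R : realType) (d e : nat) (u : 'rV[R]_d) (v : 'rV[R]_e) :
  enorm (row_mx u v) ^+ 2 = enorm u ^+ 2 + enorm v ^+ 2.
Proof.
rewrite !enorm_sqr /dotr big_split_ord /=.
by congr (_ + _); apply: eq_bigr => i _; rewrite ?row_mxEl ?row_mxEr.
Qed.

Lemma enorm_row_mx_le (R : realType) (d e : nat) (u : 'rV[R]_d) (v : 'rV[R]_e) :
  enorm (row_mx u v) <= enorm u + enorm v.
Proof.
rewrite -(@ler_pXn2r _ 2) ?nnegrE ?addr_ge0 ?enorm_ge0 // enorm_row_mx.
by have := mulr_ge0 (enorm_ge0 u) (enorm_ge0 v); nra.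
Qed.

(** * Derivatives along lines, the descent lemma and the gradient of H *)

Lemma is_derive_line (R : realType) (d : nat) (g : 'rV[R]_d -> R)
    (x v : 'rV[R]_d) (t : R) :
  differentiable g (x + t *: v) ->
  is_derive t 1 (fun t : R => g (x + t *: v))
    (dotr (gradient g (x + t *: v)) v).
Proof.
move=> dg.
have quotE : (fun h : R => h^-1 *: (((fun t : R => g (x + t *: v)) \o shift t)
    (h *: 1) - g (x + t *: v))) =
  (fun h => h^-1 *: ((g \o shift (x + t *: v)) (h *: v) - g (x + t *: v))).
  apply/funext => h; congr (_ *: (g _ - _)).
  by rewrite /= -[h *: 1]/(h * 1) mulr1 scalerDl addrCA.
have dv := diff_derivable (v := v) dg.
apply: DeriveDef; first by rewrite /derivable quotE.
by rewrite /derive quotE -[dotr _ _]gradientE -deriveE.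
Qed.

(** The claim is [F 1 <= F 0] for [F t = g (x + t v) - c t - k t^2]. Its derivative [<grad g (x + t
    v) - grad g x, v> - L t |v|^2] is nonpositive on [0, 1] by Cauchy-Schwarz and the Lipschitz
    bound, so the mean value theorem applies. *)
Lemma descent_lemma (R : realType) (d : nat) (L : R) (g : 'rV[R]_d -> R)
    (x y : 'rV[R]_d) : lipschitz_gradient L g ->
  g y <= g x + dotr (gradient g x) (y - x) + L / 2 * enorm (y - x) ^+ 2.
Proof.
move=> [dg L0 Lg]; set v : 'rV[R]_d := y - x.
set c := dotr _ v; set k := L / 2 * enorm v ^+ 2.
pose F : R -> R := (fun t : R => g (x + t *: v)) - c *: id - k *: (id ^+ 2).
have dF (t : R) : is_derive t 1 F (dotr (gradient g (x + t *: v)) v - c - k * (2 * t)).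
  have := is_derive_line (v := v) (dg (x + t *: v)) => ?.
  by apply: is_derive_eq; rewrite /GRing.scale /= expr1 !mulr1.
have [t /itvP t01 FE] : exists2 t, t \in `[0, 1] &
    F 1 - F 0 = (dotr (gradient g (x + t *: v)) v - c - k * (2 * t)) * (1 - 0).
  by apply: MVT_segment => //; apply: derivable_within_continuous => t _.
rewrite subr0 mulr1 in FE.
have : F 1 - F 0 <= 0.
  rewrite FE /c -[- dotr _ _]dotrNl -dotrDl.
  have := cauchy_schwarz (gradient g (x + t *: v) - gradient g x) v.
  have := Lg (x + t *: v) x.
  have -> : x + t *: v - x = t *: v by rewrite addrC addKr.
  rewrite enormZ ger0_norm ?t01 //.
  have := enorm_ge0 v; rewrite /k; nra.
have -> : g y = g (x + v) by rewrite /v addrC subrK.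
rewrite /F !fctE /= scale1r scale0r addr0.
by rewrite /GRing.scale /= expr1n expr0n /= !mulr1 !mulr0; lra.
Qed.

(** On the line [z + t w], H is [g (a + t b)] plus a quadratic polynomial in [t]. Its derivative at
    0 is computed once from this form and once from ['d (Hrow g) z], and the two values agree by
    uniqueness. *)
Lemma diff_Hrow (R : realType) (m : nat) (g : 'rV[R]_m -> R)
    (z w : 'rV[R]_(m + m)) :
  differentiable (Hrow g) z -> differentiable g (lsubmx z) ->
  'd (Hrow g) z w = dotr (gradient g (lsubmx z)) (lsubmx w) +
    dotr (rsubmx z - lsubmx z) (rsubmx w - lsubmx w).
Proof.
set a := lsubmx z; set b := lsubmx w.
set p := rsubmx z - a; set q := rsubmx w - b => dH dg.
have eqH : (fun t : R => Hrow g (z + t *: w)) =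
  (fun t : R => g (a + t *: b)) + cst (2^-1 * enorm p ^+ 2) + (dotr p q) *: id
  + (2^-1 * enorm q ^+ 2) *: (id ^+ 2).
  apply/funext => t; rewrite !fctE /Hrow /Hfun.
  have -> : rsubmx (z + t *: w) - lsubmx (z + t *: w) = p + t *: q.
    by apply/rowP => i; rewrite !mxE; ring.
  have -> : lsubmx (z + t *: w) = a + t *: b.
    by apply/rowP => i; rewrite !mxE.
  by rewrite enorm_sqrDZ /GRing.scale /=; field.
have dgl : is_derive (0 : R) 1 (fun t : R => g (a + t *: b))
    (dotr (gradient g a) b).
  have := @is_derive_line _ _ g a b 0; rewrite scale0r addr0; exact.
have : is_derive (0 : R) 1 (fun t : R => Hrow g (z + t *: w))
    (dotr (gradient g a) b + dotr p q).
  rewrite eqH; apply: is_derive_eq.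
  rewrite /GRing.scale /=; ring.
have : is_derive (0 : R) 1 (fun t : R => Hrow g (z + t *: w))
    (dotr (gradient (Hrow g) z) w).
  have := @is_derive_line _ _ (Hrow g) z w 0; rewrite scale0r addr0; exact.
rewrite -[X in is_derive _ _ _ X]gradientE.
by move=> /@derive_val <- /@derive_val <-.
Qed.

Lemma enorm_lsubmx_le (R : realType) (d e : nat) (w : 'rV[R]_(d + e)) :
  enorm (lsubmx w) <= enorm w.
Proof.
rewrite -(@ler_pXn2r _ 2) ?nnegrE ?enorm_ge0 // -[in leRHS](hsubmxK w).
by rewrite enorm_row_mx lerDl sqr_ge0.
Qed.

Lemma enorm_rsubmx_le (R : realType) (d e : nat) (w : 'rV[R]_(d + e)) :
  enorm (rsubmx w) <= enorm w.
Proof.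
rewrite -(@ler_pXn2r _ 2) ?nnegrE ?enorm_ge0 // -[in leRHS](hsubmxK w).
by rewrite enorm_row_mx lerDr sqr_ge0.
Qed.

Lemma enorm_gradient_Hrow_le (R : realType) (m : nat) (g : 'rV[R]_m -> R)
    (a b : 'rV[R]_m) :
  differentiable (Hrow g) (row_mx a b) -> differentiable g a ->
  enorm (gradient (Hrow g) (row_mx a b)) <=
    enorm (gradient g a) + 2 * enorm (b - a).
Proof.
(* |w|^2 = 'd H z w for w = grad H(z), so bounding 'd H z bounds |w|. *)
set z := row_mx a b => dH dg; set w := gradient _ z.
have dgl : differentiable g (lsubmx z) by rewrite row_mxKl.
have [->|w0] := eqVneq (enorm w) 0.
  by rewrite addr_ge0 ?mulr_ge0 ?enorm_ge0.
have {w0} w0 : 0 < enorm w by rewrite lt0r w0 enorm_ge0.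
rewrite -(ler_pM2r w0) -expr2 enorm_sqr -[dotr w w]gradientE diff_Hrow //.
rewrite row_mxKl row_mxKr.
have := cauchy_schwarz (gradient g a) (lsubmx w).
have := cauchy_schwarz (b - a) (rsubmx w - lsubmx w).
have := enormB (rsubmx w) (lsubmx w).
have := enorm_lsubmx_le w; have := enorm_rsubmx_le w.
have := enorm_ge0 (gradient g a); have := enorm_ge0 (b - a); nra.
Qed.

(** * Desingularizing functions and convergence under the KL inequality *)

(** A concave function lies below its tangent at [a]: for [0 < h <= 1] concavity bounds the quotient
    [(phi (a + (b - a) h) - phi a) / h] below by [phi b - phi a], and [h] tends to 0 from the right.
    The point [b = 0] is allowed, where [phi] need not be differentiable. *)
Lemma desingularizing_tangent (R : realType) (eta : \bar R) (phi : R -> R)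
    (a b : R) : desingularizing eta phi ->
  0 < a -> (a%:E < eta)%E -> 0 <= b <= a ->
  derive1 phi a * (a - b) <= phi a - phi b.
Proof.
move=> [_ cphi _ _ dphi] a0 aeta /andP[b0 ba].
have [dpa _ _] := dphi _ a0 aeta.
have dG : is_derive (0 : R) 1 (phi \o (cst a + (b - a) *: id))
    (derive1 phi a * (b - a)).
  apply: is_derive1_comp; last first.
    by apply: is_derive_eq; rewrite add0r /GRing.scale /= mulr1.
  by rewrite !fctE scaler0 addr0 derive1E; exact: derivableP.
suff : phi b - phi a <= derive1 phi a * (b - a) by lra.
have := @ex_derive _ _ _ _ _ _ _ dG; rewrite /derivable => cG.
have := @derive_val _ _ _ _ _ _ _ dG; rewrite /derive => <-.
rewrite cvg_at_rightE //; apply: limr_ge.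
  exact/cvgP/cvg_dnbhs_at_right/cG.
near=> h.
have h0 : 0 < h by [].
have h1 : h <= 1 by near: h; exact: nbhs_right_le.
have hh1 : 0 <= 1 - h by rewrite subr_ge0.
have hh2 : 1 - h <= 1 by rewrite lerBlDr lerDl ltW.
have := cphi (Itv01 hh1 hh2) a b; rewrite !inE /= => /(_ _ _)/wrap[].
  by split => //; exact: ltW.
  by split => //; rewrite (le_lt_trans _ aeta) ?lee_fin.
rewrite !convRE /= /unstable.onem => H.
rewrite /GRing.scale /= !fctE /GRing.scale /= mulr1 !addr0 scaler0 addr0.
rewrite ler_pdivlMl //.
have -> : a + (b - a) * h = (1 - h) * a + (1 - (1 - h)) * b by ring.
move: H; lra.
Unshelve. all: by end_near.
Qed.

(** From [N] on, [u] decreases to a limit, so [c a_n^2] is at most the gap between [u n] and that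
    limit. *)
Lemma sqr_decrease_cvg0 (R : realType) (u a : nat -> R) (c l : R) (N : nat) :
  0 < c -> (forall n, 0 <= a n) -> (forall n, l <= u n) ->
  (forall n, (N <= n)%N -> c * a n ^+ 2 <= u n - u n.+1) ->
  a @ \oo --> 0.
Proof.
move=> c0 a0 lu ua; pose v n := u (n + N)%N.
have vdecr : nonincreasing_seq v.
  apply/nonincreasing_seqP => n; rewrite -subr_ge0.
  apply: le_trans (ua _ (leq_addl n N)).
  by rewrite mulr_ge0 ?sqr_ge0 // ltW.
have cv : cvgn v.
  by apply: nonincreasing_is_cvgn => //; exists l => _ [n _ <-]; exact: lu.
apply/cvgrPdist_lt => e e0.
have ce0 : 0 < c * e ^+ 2 by rewrite mulr_gt0 ?exprn_gt0.
have [M _ hM] := (cvgrPdist_lt _ _).1 cv _ ce0.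
exists (M + N)%N => // n /= Mn; rewrite sub0r normrN ger0_norm //.
have Nn : (N <= n)%N by exact: leq_trans (leq_addl _ _) Mn.
have := hM (n - N)%N; rewrite /= leq_subRL // addnC => /(_ Mn).
have := nonincreasing_cvgn_ge vdecr cv (n - N).+1.
rewrite /v addSn subnK // => h1; rewrite distrC => /ltr_normlW h2.
rewrite -(@ltr_pXn2r _ 2) ?nnegrE ?(ltW e0) // -(ltr_pM2l c0).
by have := ua n Nn; lra.
Qed.

Lemma desingularizing_near0 (R : realType) (eta : \bar R) (phi : R -> R)
    (e : R) : (0 < eta)%E -> desingularizing eta phi -> 0 < e ->
  exists2 t0, 0 < t0 & forall t, 0 <= t < t0 -> (t%:E < eta)%E /\ phi t < e.
Proof.
move=> eta0 [_ _ cphi phi0 _] e0.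
(* [eta] may be infinite; [t1] is a finite positive bound below it. *)
have [t1 t10 t1eta] : exists2 t1, 0 < t1 & (t1%:E <= eta)%E.
  case: eta eta0 {cphi} => [r||] //; last by exists 1; rewrite ?leey.
  by rewrite lte_fin => r0; exists r.
have I0 : [set t : R | 0 <= t /\ (t%:E < eta)%E] 0 by [].
have /cvgrPdist_lt/(_ e e0)/nbhs_ballP[t2 /= t20 ht2] :=
  (subspace_continuousP _ _).1 cphi _ I0.
exists (Num.min t1 t2); first by rewrite lt_min t10.
move=> t /andP[t0]; rewrite lt_min => /andP[tt1 tt2].
have teta : (t%:E < eta)%E by rewrite (lt_le_trans _ t1eta) // lte_fin.
split=> //; have : `|phi 0 - phi t| < e.
  by apply: ht2 => //; rewrite /ball /= sub0r normrN ger0_norm.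
by rewrite phi0 sub0r normrN => /ltr_normlW.
Qed.

(** Three separate sequences are used because the energy is evaluated at [z n] while the cluster
    point and the limit concern [x n]; [a n] links them by bounding the steps of [x], the gradient
    at [z n] and the distance of [z n] to [zbar]. *)
Lemma KL_descent_cvg (R : realType) (k m : nat) (f : 'rV[R]_k -> R)
    (zbar : 'rV[R]_k) (z : nat -> 'rV[R]_k) (xbar : 'rV[R]_m)
    (x : nat -> 'rV[R]_m) (a : nat -> R) (c C D : R) (N : nat) :
  0 < c -> 0 < C -> 0 < D ->
  KL_property f zbar ->
  (forall n, 0 <= a n) -> a @ \oo --> 0 ->
  (forall n, (N <= n)%N -> c * a n ^+ 2 <= f (z n) - f (z n.+1)) ->
  (forall n, (N <= n)%N -> enorm (gradient f (z n)) <= C * a n) ->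
  (forall n, enorm (z n - zbar) <= D * (enorm (x n - xbar) + a n)) ->
  (forall n, enorm (x n.+1 - x n) <= a n) ->
  cluster (x @ \oo) xbar ->
  x @ \oo --> xbar.
Proof.
move=> c0 C0 D0 [df [eta [U [phi [eta0 Uz hphi hU]]]]] a0 acvg fdecr fgrad.
move=> zx xa xcl.
have [phi_ge0 _ _ _ dphi] := hphi.
have ale e : 0 < e -> exists M, forall n, (M <= n)%N -> a n < e.
  move=> e0; have [M _ hM] := (cvgrPdist_lt _ _).1 acvg _ e0.
  by exists M => n /hM /=; rewrite sub0r normrN ger0_norm.
have xfreq e n : 0 < e -> exists2 p, (n <= p)%N & enorm (x p - xbar) < e.
  move=> e0.
  have [||v [[p np <-]]] := xcl (x @` [set p | (n <= p)%N])
      [set v | enorm (v - xbar) < e].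
  - by exists n => // p /= np; exists p.
  - by apply/nbhs_enormP; exists e.
  - by exists p.
have ffreq e n : 0 < e -> exists p,
    [/\ (n <= p)%N, enorm (x p - xbar) < e & `|f zbar - f (z p)| < e].
  move=> e0; have /differentiable_continuous/cvgrPdist_lt/(_ e e0) := df zbar.
  move=> /nbhs_enormP[r r0 hr].
  (* With [|x p - xbar|] and [a p] both below [r / (2 D)], the bound [zx] puts [z p] within [r] of
     [zbar]. *)
  have r20 : 0 < r / (2 * D) by rewrite divr_gt0 // mulr_gt0.
  have [M hM] := ale _ r20.
  have [|p] := xfreq (Num.min e (r / (2 * D))) (maxn n M).
    by rewrite lt_min e0.
  rewrite geq_max lt_min => /andP[np Mp] /andP[xe xr].
  exists p; split => //; apply: hr; apply: le_lt_trans (zx p) _.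
  have := hM p Mp; move: xr; rewrite !ltr_pdivlMr ?mulr_gt0 //; lra.
have fmono n p : (N <= n)%N -> (n <= p)%N -> f (z p) <= f (z n).
  move=> Nn /subnK <-; elim: (p - n)%N => // j IH; apply: le_trans IH.
  rewrite addSn -subr_ge0; apply: le_trans (fdecr _ _).
    by rewrite mulr_ge0 ?sqr_ge0 // ltW.
  exact: leq_trans Nn (leq_addl _ _).
(* The values [f (z n)] decrease and return arbitrarily close to [f zbar], so they cannot drop below
   it. *)
have fge n : (N <= n)%N -> f zbar <= f (z n).
  move=> Nn; apply/ler_addgt0Pr => e e0.
  have [p [np _ /ltr_normlW]] := ffreq e n e0.
  by have := fmono n p Nn np; lra.
have [r r0 hr] := (nbhs_enormP _ _).1 Uz.
suff xlt e : 0 < e -> exists p, forall n, (p <= n)%N -> enorm (x n - xbar) < e.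
  move=> V /nbhs_enormP[e e0 hV]; have [p hp] := xlt e e0.
  by exists p => // n /= /hp/hV.
move=> e0.
(* A radius serving two ends: [rho <= e] for the conclusion, and [D (rho + rho) <= r] to keep [z n]
   in [U]. *)
set rho := Num.min e (r / (2 * D)).
have rho0 : 0 < rho by rewrite lt_min e0 divr_gt0 // mulr_gt0.
have rho_r : rho * (2 * D) <= r.
  by rewrite -ler_pdivlMr ?mulr_gt0 // /rho ge_min lexx orbT.
(* Half of [rho] is reserved for [|x p - xbar|], the other half for [C / c * phi (t p)]. *)
have e10 : 0 < rho / 2 * (c / C) by rewrite mulr_gt0 ?divr_gt0.
have [t0 t00 ht0] := desingularizing_near0 eta0 hphi e10.
have [M hM] := ale _ rho0.
have [|p] := ffreq (Num.min (rho / 2) t0) (maxn N M).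
  by rewrite lt_min t00 divr_gt0.
rewrite geq_max !lt_min => -[/andP[Np Mp] /andP[xp _] /andP[_ fp]].
pose t n := f (z n) - f zbar.
have t_ge0 n : (p <= n)%N -> 0 <= t n.
  by move=> pn; rewrite subr_ge0 fge // (leq_trans Np).
have t_lt n : (p <= n)%N -> t n < t0.
  move=> pn; have := fmono p n Np pn; move: fp; rewrite distrC => /ltr_normlW.
  by rewrite /t; lra.
have t_eta n : (p <= n)%N -> ((t n)%:E < eta)%E.
  by move=> pn; have [] // := ht0 (t n); rewrite t_ge0 ?t_lt.
have phit n : (p <= n)%N -> 0 <= phi (t n).
  by move=> pn; apply: phi_ge0; split; [exact: t_ge0|exact: t_eta].
have start : enorm (x p - xbar) + C / c * phi (t p) < rho.
  have [_] := ht0 (t p) (introT andP (conj (t_ge0 _ (leqnn p)) (t_lt _ (leqnn p)))).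
  rewrite -(ltr_pM2l (divr_gt0 C0 c0)).
  have -> : C / c * (rho / 2 * (c / C)) = rho / 2 by field; rewrite !gt_eqF.
  lra.
suff inv n : (p <= n)%N -> enorm (x n - xbar) + C / c * phi (t n) < rho.
  exists p => n pn; have := inv n pn.
  have : 0 <= C / c * phi (t n) by rewrite mulr_ge0 ?phit // ltW // divr_gt0.
  have : rho <= e by rewrite ge_min lexx.
  lra.
move=> /subnK <-; elim: (n - p)%N => // j; set q := (j + p)%N.
rewrite addSn -/q => IH.
have pq : (p <= q)%N by exact: leq_addl.
have Nq := leq_trans Np pq; have Mq := leq_trans Mp pq.
have Uzq : U (z q).
  apply: hr; apply: le_lt_trans (zx q) _.
  have : 0 <= C / c * phi (t q) by rewrite mulr_ge0 ?phit // ltW // divr_gt0.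
  have := hM q Mq => aq phiq.
  apply: lt_le_trans rho_r; have -> : rho * (2 * D) = D * (2 * rho) by ring.
  rewrite ltr_pM2l //; lra.
have step : a q <= C / c * (phi (t q) - phi (t q.+1)).
  have fq := fdecr q Nq.
  have tq1 := t_ge0 q.+1 (leqW pq).
  (* The KL inequality holds only where [f (z q) > f zbar]. If [t q = 0], then [t q.+1 = 0] as well,
     and the decrease forces [a q = 0]. *)
  have := t_ge0 q pq; rewrite le_eqVlt => /predU1P[tq0|tq0].
    have aq0 : c * a q ^+ 2 <= 0 by move: fq tq1 tq0; rewrite /t; lra.
    have tq10 : t q.+1 = t q.
      apply/eqP; rewrite eq_le -tq0 tq1 andbT.
      have : 0 <= c * a q ^+ 2 by rewrite mulr_ge0 ?sqr_ge0 // ltW.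
      by move: fq tq0; rewrite /t; lra.
    by rewrite tq10 subrr mulr0; rewrite pmulr_rle0 // in aq0; have := a0 q; nra.
  have [_ _ dphi0] := dphi _ tq0 (t_eta q pq).
  have tqq : 0 <= t q.+1 <= t q.
    by rewrite tq1 lerD2r fmono.
  have tang := desingularizing_tangent hphi tq0 (t_eta q pq) tqq.
  have fqz : f zbar < f (z q) by rewrite -subr_gt0.
  have := hU _ Uzq fqz; rewrite addeC -lteBlDr // -EFinB => /(_ (t_eta q pq)).
  rewrite -/(t q) => kl.
  have gq := fgrad q Nq.
  set P := derive1 phi (t q) in kl dphi0 tang.
  have kl' : 1 <= P * (C * a q) by apply: le_trans kl _; rewrite ler_pM2l.
  have fq' : c * a q ^+ 2 <= t q - t q.+1 by rewrite /t; lra.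
  have h1 : P * (c * a q ^+ 2) <= phi (t q) - phi (t q.+1).
    by apply: le_trans tang; rewrite ler_pM2l.
  (* Multiplying [kl'] by [c * a q] and inserting [h1] gives [c a <= C P c a^2 <= C (phi (t q) - phi
     (t q.+1))] for [a = a q]. *)
  rewrite mulrAC ler_pdivlMr //.
  apply: le_trans (ler_wpM2l (ltW C0) h1).
  have := ler_wpM2r (mulr_ge0 (a0 q) (ltW c0)) kl'; lra.
have := enormD (x q.+1 - x q) (x q - xbar); rewrite addrA subrK.
have := xa q; lra.
Qed.

(** * Energy decrease along the inertial iteration *)

(* Both sides are multiplied by [s], with [l = s * L], to avoid divisions. *)
Lemma inertial_descent (R : realType) (d : nat) (L s b0 b1 : R)
    (g : 'rV[R]_d -> R) (y0 y1 p q : 'rV[R]_d) (l := s * L) :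
  lipschitz_gradient L g -> 0 < s -> 0 <= b0 ->
  l * (1 + b1) <= 2 + b1 ->
  s *: gradient g y0 = b0 *: p - q -> y1 - y0 = (1 + b1) *: q - b0 *: p ->
  s * (g y1 - g y0) <=
    ((1 + b1) * (l * (1 + b1) / 2 - 1) + b0 * (2 + b1 - l * (1 + b1)) / 2)
      * enorm q ^+ 2 +
    (b0 ^+ 2 * (l / 2 - 1) + b0 * (2 + b1 - l * (1 + b1)) / 2) * enorm p ^+ 2.
Proof.
move=> hg s0 b00 lb sg ydiff.
have desc := descent_lemma y0 y1 hg.
have sdesc : s * (g y1 - g y0) <=
    dotr (s *: gradient g y0) (y1 - y0) + l / 2 * enorm (y1 - y0) ^+ 2.
  rewrite dotrZl.
  have -> : l / 2 * enorm (y1 - y0) ^+ 2 = s * (L / 2 * enorm (y1 - y0) ^+ 2).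
    by rewrite /l; ring.
  by rewrite -mulrDr ler_pM2l //; lra.
apply: le_trans sdesc _; rewrite sg ydiff enorm_sqr !dotrE (dotrC q p).
rewrite -!enorm_sqr.
(* The cross term [dotr p q] carries the coefficient [b0 * (2 + b1 - l * (1 + b1))], nonnegative by
   the hypothesis on [l], so it may be split equally between the two squares. *)
have amgm : dotr p q <= (enorm p ^+ 2 + enorm q ^+ 2) / 2.
  by have := cauchy_schwarz p q; have := sqr_ge0 (enorm p - enorm q); nra.
have B0 : 0 <= b0 * (2 + b1 - l * (1 + b1)) by rewrite mulr_ge0 // subr_ge0.
have := ler_wpM2l B0 amgm; lra.
Qed.

Lemma inertial_coef_cvg (R : realType) (alpha beta : R) :
  0 < alpha -> 0 < beta ->
  (fun n => beta * n%:R / (n%:R + alpha)) @ \oo --> beta.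
Proof.
move=> alpha0 beta0; apply/cvgrPdist_lt => e e0; near=> n.
have na : 0 < n%:R + alpha by rewrite ltr_wpDl.
have -> : beta - beta * n%:R / (n%:R + alpha) = beta * alpha / (n%:R + alpha).
  by field; rewrite gt_eqF.
rewrite ger0_norm; last by rewrite divr_ge0 ?mulr_ge0 // ltW.
rewrite ltr_pdivrMr // mulrDr ltr_wpDr ?mulr_ge0 ?(ltW e0) ?(ltW alpha0) //.
rewrite [e * _]mulrC -ltr_pdivrMr //; near: n; exact: nbhs_infty_gtr.
Unshelve. all: by end_near.
Qed.

(** These are the coefficients of [inertial_descent] corrected by the [del] terms of the energy.
    They are polynomials in [b n] and [b n.+1], so a strict bound at the limit persists for large
    [n]. *)
Lemma inertial_coefs_near (R : realType) (b : nat -> R) (beta l del e : R) :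
  b @ \oo --> beta ->
  (1 + beta) * (l * (1 + beta) / 2 - 1) +
    beta * (2 + beta - l * (1 + beta)) / 2 + del < e ->
  beta ^+ 2 * (l / 2 - 1) + beta * (2 + beta - l * (1 + beta)) / 2 - del < e ->
  \forall n \near \oo,
    (1 + b n.+1) * (l * (1 + b n.+1) / 2 - 1) +
      b n * (2 + b n.+1 - l * (1 + b n.+1)) / 2 + del < e /\
    b n ^+ 2 * (l / 2 - 1) + b n * (2 + b n.+1 - l * (1 + b n.+1)) / 2 - del < e.
Proof.
move=> bb h1 h2.
have b1 : b n.+1 @[n --> \oo] --> beta.
  by move: bb; rewrite -cvg_shiftS.
have c1 : 1 + b n.+1 @[n --> \oo] --> 1 + beta by apply: cvgD => //; exact: cvg_cst.
have lc1 : l * (1 + b n.+1) @[n --> \oo] --> l * (1 + beta).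
  by apply: cvgM => //; exact: cvg_cst.
have B : b n * (2 + b n.+1 - l * (1 + b n.+1)) / 2 @[n --> \oo] -->
    beta * (2 + beta - l * (1 + beta)) / 2.
  apply: cvgM; last exact: cvg_cst.
  by apply: cvgM => //; apply: cvgB => //; apply: cvgD => //; exact: cvg_cst.
have A1 : (1 + b n.+1) * (l * (1 + b n.+1) / 2 - 1) +
      b n * (2 + b n.+1 - l * (1 + b n.+1)) / 2 + del @[n --> \oo] -->
   (1 + beta) * (l * (1 + beta) / 2 - 1) +
    beta * (2 + beta - l * (1 + beta)) / 2 + del.
  apply: cvgD; last exact: cvg_cst.
  apply: cvgD => //; apply: cvgM => //; apply: cvgB; last exact: cvg_cst.
  by apply: cvgM => //; exact: cvg_cst.
have A2 : b n ^+ 2 * (l / 2 - 1) + b n * (2 + b n.+1 - l * (1 + b n.+1)) / 2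
     - del @[n --> \oo] -->
  beta ^+ 2 * (l / 2 - 1) + beta * (2 + beta - l * (1 + beta)) / 2 - del.
  apply: cvgB; last exact: cvg_cst.
  apply: cvgD => //; apply: cvgM; last exact: cvg_cst.
  by rewrite expr2; under eq_fun do rewrite expr2; exact: cvgM.
near=> n; split; near: n; [exact: cvgr_lt A1 _ h1|exact: cvgr_lt A2 _ h2].
Unshelve. all: by end_near.
Qed.

(** * Convergence of the inertial iteration to a critical point *)

(* [hs]: the bound 2 (1 - beta) / L is read as +oo when L = 0. *)
Theorem theorem1 (R : realType) (m : nat) (g : 'rV[R]_m -> R)
    (L alpha beta s : R) (xm1 xs : 'rV[R]_m) (x y : nat -> 'rV[R]_m)
    (hg : lipschitz_gradient L g)
    (halpha : 0 < alpha)
    (hbeta : 0 < beta < 1)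
    (hs0 : 0 < s)
    (hs : 0 < L -> s < 2 * (1 - beta) / L)
    (hy : forall n : nat,
      y n = x n + (beta * n%:R / (n%:R + alpha)) *: (x n - prev_term xm1 x n))
    (hx : forall n : nat, x n.+1 = y n - s *: gradient g (y n))
    (hbelow : has_lbound (range g))
    (hcluster : cluster (x @ \oo) xs)
    (hKL : KL_property (Hrow g) (row_mx xs xs)) :
  (x @ \oo --> xs) /\ gradient g xs = 0.
Proof.
have [dg L0 Lg] := hg; have [beta0 beta1] := andP hbeta.
pose b n : R := beta * n%:R / (n%:R + alpha).
pose d n := x n - prev_term xm1 x n.
pose a n := enorm (d n) + enorm (d n.+1).
pose l := s * L.
(* [K > 0] is the step-size condition [s L < 2 (1 - beta)]. *)
pose K := 1 - beta - l / 2.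
(* del makes the limit coefficients of |d_n|^2 and |d_(n+1)|^2 in the energy
   decrease both equal to - K / 2. *)
pose del := (2 + 2 * beta - 2 * beta ^+ 2 - l * (1 + 2 * beta)) / 4.
have l0 : 0 <= l by rewrite mulr_ge0 // ltW.
have l_lt : l < 2 * (1 - beta).
  have [L00|L00] := leP L 0; last by rewrite /l -ltr_pdivlMr // hs.
  have L_eq0 : L = 0 by apply/le_anti/andP.
  by rewrite /l L_eq0 mulr0; lra.
have K0 : 0 < K by rewrite /K; lra.
(* [l_lt] gives [l (1 + 2 beta) <= 2 + 2 beta - 4 beta^2]. *)
have del0 : 0 <= del by rewrite /del; nra.
have bcvg : b @ \oo --> beta by exact: inertial_coef_cvg.
have na n : 0 < n%:R + alpha by rewrite ltr_wpDl.
have b_ge0 n : 0 <= b n by rewrite divr_ge0 ?mulr_ge0 // ltW.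
have b_le n : b n <= beta.
  rewrite ler_pdivrMr // mulrDr lerDl mulr_ge0 // ltW //.
have a_ge0 n : 0 <= a n by rewrite addr_ge0 ?enorm_ge0.
have sgrad n : s *: gradient g (y n) = b n *: d n - d n.+1.
  have -> : d n.+1 = y n - s *: gradient g (y n) - x n by rewrite -hx.
  by rewrite {2}hy -/(b n) -/(d n); apply/rowP => i; rewrite !mxE; ring.
have ydiff n : y n.+1 - y n = (1 + b n.+1) *: d n.+1 - b n *: d n.
  rewrite !hy -/(b n) -/(b n.+1) -/(d n) -/(d n.+1).
  have -> : x n.+1 = x n + d n.+1 by rewrite /d /= addrC subrK.
  by apply/rowP => i; rewrite !mxE; ring.
have grad_le n : enorm (gradient g (y n)) <= s^-1 * a n.
  rewrite ler_pdivlMl // -(ger0_norm (ltW hs0)) -enormZ sgrad.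
  apply: le_trans (enormB _ _) _; rewrite enormZ ger0_norm // lerD2r.
  by rewrite ler_piMl ?enorm_ge0 // (le_trans (b_le n)) // ltW.
have y_le n : enorm (y n - xs) <= enorm (x n - xs) + a n.
  rewrite hy -/(b n) -/(d n) addrAC; apply: le_trans (enormD _ _) _.
  rewrite lerD2l enormZ ger0_norm // /a.
  have := enorm_ge0 (d n.+1); have := b_le n; have := enorm_ge0 (d n); nra.
pose kap := Num.sqrt (2 * del / s).
have kap_ge0 : 0 <= kap by exact: sqrtr_ge0.
pose z n := row_mx (y n) (y n + kap *: d n).
have HE n : Hrow g (z n) = g (y n) + del / s * enorm (d n) ^+ 2.
  rewrite /Hrow /Hfun row_mxKl row_mxKr [y n + _]addrC addrK enormZ exprMn.
  rewrite real_normK ?num_real // sqr_sqrtr.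
    by congr (_ + _); field; rewrite gt_eqF.
  by apply: divr_ge0; [exact: mulr_ge0|exact: ltW].
(* Both limits equal [- K / 2], so [- (K / 4)] is a strict upper bound for them and is still
   negative. *)
have [N _ hN] : \forall n \near \oo,
    (1 + b n.+1) * (l * (1 + b n.+1) / 2 - 1) +
      b n * (2 + b n.+1 - l * (1 + b n.+1)) / 2 + del < - (K / 4) /\
    b n ^+ 2 * (l / 2 - 1) + b n * (2 + b n.+1 - l * (1 + b n.+1)) / 2 - del
      < - (K / 4).
  by apply: inertial_coefs_near bcvg _ _; rewrite /del /K; nra.
(* The constant is [K / 4] from the coefficients, halved by [(u + v)^2 <= 2 (u^2 + v^2)] and divided
   by the factor [s] of [inertial_descent]. *)
have decr n : (N <= n)%N ->
    K / (8 * s) * a n ^+ 2 <= Hrow g (z n) - Hrow g (z n.+1).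
  move=> /hN /= [h1 h2].
  have lb : s * L * (1 + b n.+1) <= 2 + b n.+1.
    by rewrite -/l; have := b_ge0 n.+1; have := b_le n.+1; nra.
  have := inertial_descent hg hs0 (b_ge0 n) lb (sgrad n)
    (ydiff n).
  rewrite -/l => desc; rewrite !HE -(ler_pM2l hs0).
  have -> : s * (K / (8 * s) * a n ^+ 2) = K / 8 * a n ^+ 2.
    by field; rewrite gt_eqF.
  have -> : s * (g (y n) + del / s * enorm (d n) ^+ 2 -
      (g (y n.+1) + del / s * enorm (d n.+1) ^+ 2)) =
      - (s * (g (y n.+1) - g (y n))) + del * enorm (d n) ^+ 2
      - del * enorm (d n.+1) ^+ 2.
    by field; rewrite gt_eqF.
  have aa : a n ^+ 2 <= 2 * (enorm (d n) ^+ 2 + enorm (d n.+1) ^+ 2).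
    by have := sqr_ge0 (enorm (d n) - enorm (d n.+1)); rewrite /a; lra.
  have := ler_wpM2r (sqr_ge0 (enorm (d n.+1))) (ltW h1).
  have := ler_wpM2r (sqr_ge0 (enorm (d n))) (ltW h2).
  have := ler_wpM2l (ltW K0) aa.
  lra.
have c0 : 0 < K / (8 * s) by rewrite divr_gt0 // mulr_gt0.
have acvg : a @ \oo --> 0.
  have [lo hlo] := hbelow.
  apply: (sqr_decrease_cvg0 (l := lo) c0 a_ge0 _ decr) => n.
  rewrite HE; apply: le_trans (hlo _ (imageT g (y n))) _.
  by rewrite lerDl mulr_ge0 ?sqr_ge0 // divr_ge0 // ltW.
have xcvg : x @ \oo --> xs.
  (* The gradient constant adds [s^-1] from [grad_le] to [2 * kap] from the gap [kap *: d n] between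
     the blocks of [z n]. In [2 + kap], each block contributes [|y n - xs|] and the second one also
     [kap |d n|]. *)
  apply: (@KL_descent_cvg _ _ _ _ _ z _ _ a _ (s^-1 + 2 * kap) (2 + kap) N
    c0 _ _ hKL a_ge0 acvg decr) => //.
  - by rewrite ltr_wpDr ?invr_gt0 // mulr_ge0.
  - by rewrite ltr_wpDr.
  - move=> n _; apply: le_trans (enorm_gradient_Hrow_le _ _) _ => //.
      exact: hKL.1.
    rewrite [y n + _]addrC addrK enormZ ger0_norm //.
    have da : enorm (d n) <= a n by rewrite lerDl enorm_ge0.
    have := ler_wpM2l kap_ge0 da; have := grad_le n; lra.
  - move=> n; rewrite /z opp_row_mx add_row_mx.
    apply: le_trans (enorm_row_mx_le _ _) _.
    rewrite addrAC; have := enormD (y n - xs) (kap *: d n).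
    rewrite enormZ ger0_norm //; have := y_le n.
    have : enorm (d n) <= a n by rewrite lerDl enorm_ge0.
    have := enorm_ge0 (x n - xs); nra.
  - by move=> n; rewrite lerDr enorm_ge0.
(* Criticality: [|grad g xs|] is at most [L |xs - y n| + |grad g (y n)|], hence at most
   [L (|x n - xs| + a n) + a n / s]. Once [|x n - xs|] and [a n] are below [e / M], this is at most
   [(2 L + 1 / s) e / M <= e]. *)
split=> //; apply: enorm_eq0; apply/eqP; rewrite eq_le enorm_ge0 andbT.
apply/ler_addgt0Pr => e e0; rewrite add0r.
pose M := 2 * L + s^-1 + 1.
have si0 : 0 < s^-1 by rewrite invr_gt0.
have M0 : 0 < M by rewrite /M; lra.
have eM : 0 < e / M by rewrite divr_gt0.
have [N1 _ hN1] := (cvgrPdist_lt _ _).1 acvg _ eM.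
have nb : nbhs xs [set v | enorm (v - xs) < e / M].
  by apply/nbhs_enormP; exists (e / M).
have [N2 _ hN2] := xcvg _ nb.
pose n := maxn N1 N2.
have := hN1 n (leq_maxl _ _); rewrite /= sub0r normrN ger0_norm // => an.
have := hN2 n (leq_maxr _ _) => /= xn.
have := enormD (gradient g xs - gradient g (y n)) (gradient g (y n)).
rewrite subrK => /le_trans; apply.
have := Lg xs (y n); rewrite -(enormN (xs - y n)) opprB => h1.
have h2 := ler_wpM2l L0 (y_le n); have h3 := grad_le n.
have h4 : L * (enorm (x n - xs) + a n) <= L * (2 * (e / M)).
  by rewrite ler_wpM2l //; lra.
have h5 : s^-1 * a n <= s^-1 * (e / M) by rewrite ler_pM2l // ltW.
have : M * (e / M) = e by rewrite mulrC divfK // gt_eqF.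
rewrite {1}/M; lra.
Qed.
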